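(* Let $\{X_\alpha:\alpha\in\Lambda\}$ be an indexed family of nonempty topological spaces, for each $\alpha\in\Lambda$ let $\mathcal{P}_\alpha$ be an ideal of closed sets in $X_\alpha$, let $X=\prod_{\alpha\in\Lambda}X_\alpha$ and let $\mathcal{P}=\prod_{\alpha\in\Lambda}\mathcal{P}_\alpha$ be the product ideal. Then $X$ is almost locally-$\mathcal{P}$ if and only if both of the following hold: (1) $X_\alpha$ is almost locally-$\mathcal{P}_\alpha$ for each $\alpha\in\Lambda$; (2) $X_\alpha\in\mathcal{P}_\alpha$ for all but finitely many $\alpha\in\Lambda$.
   Context: An ideal of closed sets in a space $Y$ is a family $\mathcal{Q}$ of closed subsets of $Y$ such that (1) $A,B\in\mathcal{Q}$ implies $A\cup B\in\mathcal{Q}$, and (2) $A\in\mathcal{Q}$, $B\subseteq A$ with $B$ closed in $Y$ implies $B\in\mathcal{Q}$. The product ideal $\prod_{\alpha\in\Lambda}\mathcal{P}_\alpha$ is the smallest ideal of closed sets in $\prod_{\alpha\in\Lambda}X_\alpha$ containing all sets of the form $\prod_{\alpha\in\Lambda}A_\alpha$ with $A_\alpha\in\mathcal{P}_\alpha$ for each $\alpha\in\Lambda$. For an ideal $\mathcal{Q}$ of closed sets in $Y$, the space $Y$ is almost locally-$\mathcal{Q}$ if each nonempty open set $U$ in $Y$ contains a nonempty open set $V$ such that $\mathrm{cl}_Y V\in\mathcal{Q}$. *)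

(* Defs.v *)
From mathcomp Require Import all_boot all_classical topology_theory.topology.

Set Implicit Arguments.
Unset Strict Implicit.
Unset Printing Implicit Defensive.

Local Open Scope classical_set_scope.

(* A family of closed sets is not required to be nonempty or to contain the
   empty set; nonempty ideals contain [set0] by downward closure. *)
Record closed_ideal (Y : topologicalType) (Q : set (set Y)) : Prop := {
  closed_ideal_closed : forall A, Q A -> closed A ;
  closed_idealU : forall A B, Q A -> Q B -> Q (A `|` B) ;
  closed_ideal_sub : forall A B, Q A -> B `<=` A -> closed B -> Q B
}.

Definition set_box (I : Type) (X : I -> topologicalType)
    (A : forall i, set (X i)) : set (prod_topology X) :=
  [set f | forall i, A i (f i)].

Definition product_ideal (I : Type) (X : I -> topologicalType)
    (P : forall i, set (set (X i))) : set (set (prod_topology X)) :=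
  smallest (@closed_ideal (prod_topology X))
    [set set_box A | A in [set A : forall i, set (X i) | forall i, P i (A i)]].

Definition almost_locally (Y : topologicalType) (Q : set (set Y)) : Prop :=
  forall U : set Y, open U -> U !=set0 ->
    exists V : set Y, [/\ open V, V !=set0, V `<=` U & Q (closure V)].

(* [smallest] is by definition an intersection; here it is itself an ideal. *)
Lemma product_ideal_closed_ideal (I : Type) (X : I -> topologicalType)
    (P : forall i, set (set (X i))) :
  (forall i, closed_ideal (P i)) -> closed_ideal (product_ideal P).
Proof.
move=> idP; split.
- move=> B; apply; split; first by split=> // *; exact: closedU.
  move=> _ [A PA <-].
  have -> : set_box A = \bigcap_i (@proj I X i @^-1` A i).
    by apply/seteqP; split=> [f Af i _|f Af i]; [exact: Af|exact: (Af i)].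
  apply: closed_bigI => i _; apply: preimage_closed => [f _|].
    have /cvg_sup/(_ i) cf : f --> f by exact: cvg_id.
    by move=> W /(@initial_continuous _ _ (fun g : forall j, X j => g i) f) /cf.
  exact: closed_ideal_closed (idP i) _ (PA i).
- move=> A B QA QB Q [idQ gQ].
  by apply: (closed_idealU idQ); [exact: QA|exact: QB].
- move=> A B QA BA cB Q [idQ gQ].
  by apply: (closed_ideal_sub idQ _ BA cB); exact: QA.
Qed.

(* Main.v *)
(* Projecting a member of the product ideal to any factor gives a set whose
   closure lies in the ideal of that factor: the closed sets with this property
   form an ideal containing all boxes.  A nonempty open set projects onto all
   but finitely many factors, which yields (1) and (2).  Conversely, a basic
   open box can be shrunk in finitely many factors, namely those where it is
   restricted or where the whole space is not in the ideal, so that the closures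
   of all its sides lie in the respective ideals. *)

Require Import Defs.
From mathcomp Require Import all_boot all_classical topology_theory.topology.

Local Open Scope classical_set_scope.

(** The sets containing such a box around [f] form a filter, since two boxes meet in a box. The
    product topology is a supremum of initial topologies, so convergence of this filter to [f] can
    be tested one coordinate at a time. *)
Lemma prod_nbhs_box (I : Type) (X : I -> topologicalType)
    (f : prod_topology X) (U : set (prod_topology X)) :
  nbhs f U ->
  exists W : forall i, set (X i), [/\ forall i, open (W i) /\ W i (f i),
    finite_set [set i | W i <> setT] & set_box W `<=` U].
Proof.
pose F : set_system (prod_topology X) :=
  [set U | exists W : forall i, set (X i), [/\ forall i, open (W i) /\ W i (f i),
    finite_set [set i | W i <> setT] & set_box W `<=` U]].
have FF : Filter F.
  split.
  - exists (fun=> setT); split=> //.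
    + by move=> i; split=> //; exact: openT.
    + by apply: (sub_finite_set _ (finite_set0 I)) => i /(_ erefl).
  - move=> A B [V [oV finV VA]] [W [oW finW WB]].
    exists (fun i => V i `&` W i); split.
    + move=> i; have [[oVi Vf] [oWi Wf]] := (oV i, oW i).
      by split=> //; exact: openI.
    + apply: (sub_finite_set
        (B := [set i | V i <> setT] `|` [set i | W i <> setT])).
        move=> i /= VWT; have [VT|] := pselect (V i = setT); last by left.
        by right => WT; apply: VWT; rewrite VT WT setTI.
      by rewrite finite_setU.
    + by move=> g VWg; split; [apply: VA|apply: WB] => i; have [] := VWg i.
  - by move=> A B AB [V [oV finV VA]]; exists V; split=> // g /VA /AB.
suff : F --> f by exact.
apply/cvg_sup => i A [_ [[B oB <-] /= Bf] BA].
(* The box restricted to [B] at [i] only; [{classic I}] provides the decidable equality on indices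
   that [dfwith] requires. *)
pose W := @dfwith {classic I} (fun j => set (X j)) (fun=> setT) i B.
exists W; split.
- move=> j; rewrite /W.
  case: (@dfwithP {classic I} (fun j => set (X j)) (fun=> setT) i B j) => // k _; split=> //; exact: openT.
- apply: (sub_finite_set (B := [set i])) => // j; rewrite /W /=.
  by case: (@dfwithP {classic I} (fun j => set (X j)) (fun=> setT) i B j).
- by move=> g /(_ i); rewrite /W (@dfwithin {classic I}) => /BA.
Qed.

(** Unrestricted sides impose no condition, so the box is a finite intersection of open
    cylinders. *)
Lemma open_set_box (I : Type) (X : I -> topologicalType)
    (W : forall i, set (X i)) :
  (forall i, open (W i)) -> finite_set [set i | W i <> setT] ->
  open (set_box W).
Proof.
move=> oW finW.
have -> : set_box W = \bigcap_(i in [set i : {classic I} | W i <> setT])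
    (@proj {classic I} X i @^-1` W i).
  apply/seteqP; split=> [f Wf i _|f Wf i]; first exact: Wf.
  have [WT|] := pselect (W i = setT); first by rewrite WT.
  exact: Wf.
have [D ->] := (finite_fsetP (T := {classic I})).1 finW.
rewrite openE => f Wf; apply: filter_bigI => i Di.
apply: (@proj_continuous {classic I} X i f).
apply: open_nbhs_nbhs; split; first exact: oW.
exact: Wf.
Qed.

Lemma closure_set_box (I : Type) (X : I -> topologicalType)
    (W : forall i, set (X i)) :
  closure (set_box W) `<=` set_box (fun i => closure (W i)).
Proof.
move=> f clf i B fB.
have [g [Wg Bg]] := clf _ (@proj_continuous {classic I} X i f B fB).
by exists (g i).
Qed.

Lemma product_ideal_proj (I : Type) (X : I -> topologicalType)
    (P : forall i, set (set (X i))) (P_ideal : forall i, closed_ideal (P i))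
    (B : set (prod_topology X)) (i : I) :
  product_ideal P B -> P i (closure (@proj I X i @` B)).
Proof.
move=> PB.
(* Closures are taken because the projection of a closed set need not be closed. *)
pose Q : set (set (prod_topology X)) :=
  [set B : set (prod_topology X) | closed B /\ forall i, P i (closure (@proj I X i @` B))].
suff [_ /(_ i)] : Q B by [].
apply: PB; split; first split.
- by move=> A [].
- move=> A C [cA PA] [cC PC]; split; first exact: closedU.
  by move=> j; rewrite image_setU closureU; apply: (closed_idealU (P_ideal j)).
- move=> A C [cA PA] CA cC; split=> // j.
  apply: (closed_ideal_sub (P_ideal j) (PA j)); last exact: closed_closure.
  by apply: closureS; exact: image_subset.
move=> _ [A PA <-].
have cA j : closed (A j) by apply: (closed_ideal_closed (P_ideal j)).
split.
- rewrite closure_id; apply/seteqP; split; first exact: subset_closure.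
  move=> f /closure_set_box clf j; exact/cA/clf.
- move=> j; apply: (closed_ideal_sub (P_ideal j) (PA j)); last exact: closed_closure.
  (* Only an inclusion holds in general: the image is empty as soon as some side of the box is. *)
  rewrite [X in _ `<=` X](closure_id _).1//; apply: closureS => _ [f Af <-].
  exact: Af.
Qed.

Theorem theorem3p3 (I : Type) (X : I -> topologicalType)
    (X_nonempty : forall i, [set: X i] !=set0)
    (P : forall i, set (set (X i)))
    (P_ideal : forall i, closed_ideal (P i)) :
  almost_locally (product_ideal P) <->
  (forall i, almost_locally (P i)) /\
  finite_set [set i | ~ P i [set: X i]].
Proof.
pose f0 : prod_topology X := fun i => projT1 (cid (X_nonempty i)).
split=> [alP|[alP finP]].
  (* Passing from [closure V] down to [V] matters because the projection of the open set [V] is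
     open. *)
  have projP i (V : set (prod_topology X)) : product_ideal P (closure V) ->
      P i (closure (@proj I X i @` V)).
    move=> /(product_ideal_proj _ _ _ P_ideal _ i) PclV.
    apply: (closed_ideal_sub (P_ideal i) PclV); last exact: closed_closure.
    by apply: closureS; apply: image_subset; exact: subset_closure.
  split=> [i U oU [x Ux]|].
    have oprojU : @open (prod_topology X) (@proj {classic I} X i @^-1` U).
      by apply: open_comp => // f _; exact: (@proj_continuous {classic I}).
    have [|V [oV [g Vg] VU PclV]] := alP _ oprojU.
      by exists (dfwith (I := {classic I}) f0 i x); rewrite /= projK.
    exists (@proj {classic I} X i @` V); split.
    - exact: (@proj_open {classic I} X i).
    - by exists (g i); exists g.
    - by move=> _ [f /VU Uf <-].
    - exact: projP.
  have [|V [oV [f Vf] _ PclV]] := alP setT openT; first by exists f0.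
  have [W [oW finW WV]] := prod_nbhs_box _ _ _ _ (open_nbhs_nbhs (conj oV Vf)).
  (* If [W i] is the whole factor, changing coordinate [i] of [f] to any [x] stays inside [V], so
     [V] projects onto [X i]. *)
  apply: (sub_finite_set _ finW) => i; apply: contra_not => WT.
  apply: (closed_ideal_sub (P_ideal i) (projP i _ PclV)); last exact: closedT.
  move=> x _; apply: subset_closure.
  exists (dfwith (I := {classic I}) f i x); last exact: (projK (I := {classic I})).
  apply: WV => j; case: (dfwithP (I := {classic I}) f x j) => [|k _].
    by rewrite WT.
  by have [] := oW k.
move=> U oU [f Uf].
have [W [oW finW WU]] := prod_nbhs_box _ _ _ _ (open_nbhs_nbhs (conj oU Uf)).
(* The last clause leaves a side whole whenever possible, so that the shrunken box is still
   restricted in finitely many coordinates and hence open. *)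
have shrink i : exists V : set (X i), [/\ open V, V !=set0, V `<=` W i,
    P i (closure V) & W i = setT -> P i setT -> V = setT].
  have [[WT PT]|nWP] := pselect (W i = setT /\ P i setT).
    exists setT; split=> //; [exact: openT|by rewrite WT|].
    by rewrite -(closure_id _).1//; exact: closedT.
  have [oWi Wf] := oW i.
  have [|V [oV V0 VW PV]] := alP i _ oWi; first by exists (f i).
  by exists V; split=> // WT PT; case: nWP.
pose V i := projT1 (cid (shrink i)).
have VP i : [/\ open (V i), V i !=set0, V i `<=` W i,
    P i (closure (V i)) & W i = setT -> P i setT -> V i = setT].
  exact: projT2 (cid (shrink i)).
have V0 i : V i !=set0 by have [] := VP i.
exists (set_box V); split.
- apply: open_set_box => [i|]; first by have [] := VP i.
  apply: (sub_finite_set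
    (B := [set i | W i <> setT] `|` [set i | ~ P i setT])); last first.
    by rewrite finite_setU.
  move=> i /= VT; have [WT|] := pselect (W i = setT); last by left.
  by right=> PT; apply: VT; have [_ _ _ _] := VP i; apply.
- by exists (fun i => projT1 (cid (V0 i))) => i; exact: projT2 (cid (V0 i)).
- apply: subset_trans WU => g Vg i.
  by have [_ _ + _ _] := VP i; apply; exact: Vg.
(* The closure of the box lies in the box of closures, which is a generator of the product ideal. *)
- apply: (closed_ideal_sub (product_ideal_closed_ideal P_ideal)
    _ (@closure_set_box _ _ V)); last exact: closed_closure.
  move=> Q [_]; apply; exists (fun i => closure (V i)) => // i.
  by have [] := VP i.
Qed.
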